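(* Let $\mathcal{P}_{2,3}$ be the set of odd primes $p$ with $p\equiv3\pmod4$ such that the order $s$ of $2$ in $(\mathbb{Z}/p\mathbb{Z})^*$ equals $\frac{p-1}{2}$. There exists no prime number $p\in\mathcal{P}_{2,3}$ for which $\beta>1/2$.
   Context: $\eta_n=(-1)^{s_2(n)}$ for $n\ge0$, where $s_2(n)$ is the sum of the binary digits of $n$. For an odd prime $p$ and $i\in\mathbb{Z}/p\mathbb{Z}$, the $p$-rarefied sum is $S_{p,i}(n)=\sum_{0\le j<n,\ j\equiv i\,(\mathrm{mod}\,p)}\eta_j$. With $s$ the order of $2$ in $(\mathbb{Z}/p\mathbb{Z})^*$, $\lambda_1$ denotes the largest modulus of an eigenvalue of the $p\times p$ matrix $M=(S_{p,i-j}(2^s))_{0\le i,j\le p-1}$ (indices $i-j$ taken mod $p$), and $\beta=\beta(p)=\frac{\log\lambda_1}{s\log2}$. *)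

(* Defs.v *)
From HB Require Import structures.
From mathcomp Require Import all_boot all_order all_algebra all_fingroup.
From mathcomp Require Import complex.
From mathcomp Require Import classical_sets reals exp.

Set Implicit Arguments.
Unset Strict Implicit.
Unset Printing Implicit Defensive.

Import Order.TTheory GRing.Theory Num.Theory.

Local Open Scope classical_set_scope.
Local Open Scope ring_scope.

(* Since n < 2 ^ n, all the nonzero binary digits of n have index k < n. *)
Definition s2 (n : nat) : nat := (\sum_(k < n) (n %/ 2 ^ k) %% 2)%N.

Definition eta (n : nat) : int := (-1) ^+ s2 n.

(* 'F_p is Z/pZ only when p is prime; this is the only case of interest in
   everything below. *)
Definition rarefied_sum (p : nat) (i : 'F_p) (n : nat) : int :=
  \sum_(0 <= j < n | j%:R == i) eta j.

(* The order of 2 in (Z/pZ)^*. For p = 2, where 2 is not a unit, [insubd]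
   returns its default value 1. *)
Definition ord2 (p : nat) : nat := #[insubd (1%g : {unit 'F_p}) 2%:R]%g.

Definition rarefied_mx (p : nat) : 'M[int]_p :=
  \matrix_(i < p, j < p)
    rarefied_sum ((i : nat)%:R - (j : nat)%:R : 'F_p) (2 ^ ord2 p).

Definition eigen_moduli (R : realType) (p : nat) : set R :=
  [set ComplexField.Normc.normc z
     | z in [set z : R[i] | eigenvalue (map_mx intr (rarefied_mx p)) z]].
Arguments eigen_moduli : clear implicits.

(* This set is finite and, for p > 0, nonempty, so that its supremum is its
   largest element: see [lambda1_max]. *)
Definition lambda1 (R : realType) (p : nat) : R := sup (eigen_moduli R p).

Definition beta (R : realType) (p : nat) : R :=
  ln (lambda1 R p) / ((ord2 p)%:R * ln 2%:R).

Definition P23 : set nat :=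
  [set p | [/\ prime p, odd p, (p = 3 %[mod 4])%N & ord2 p = (p.-1 %/ 2)%N]].

Lemma lambda1_max (R : realType) (p : nat) : (0 < p)%N ->
  eigen_moduli R p (lambda1 R p) /\
  (forall x, eigen_moduli R p x -> x <= lambda1 R p).
Proof.
move=> p_gt0.
set M : 'M[R[i]]_p := map_mx intr (rarefied_mx p).
have [rs rsE] := closed_field_poly_normal (char_poly M).
have lead : lead_coef (char_poly M) = 1 by apply/monicP/char_poly_monic.
rewrite lead scale1r in rsE.
have eigE z : eigenvalue M z = (z \in rs).
  by rewrite eigenvalue_root_char rsE root_prod_XsubC.
have sz : size rs = p.
  by apply: succn_inj; rewrite -(size_prod_XsubC rs id) -rsE size_char_poly.
pose N := @ComplexField.Normc.normc R.
suff [z zrs zmax] : exists2 z, z \in rs & forall y, y \in rs -> N y <= N z.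
  have ub : ubound (eigen_moduli R p) (N z).
    by move=> _ [y /= ey <-]; apply: zmax; rewrite -eigE.
  have mem : eigen_moduli R p (N z) by exists z => //=; rewrite eigE.
  have -> : lambda1 R p = N z.
    apply/eqP; rewrite eq_le; apply/andP; split.
      by apply: ge_sup => //; exists (N z).
    by apply: ub_le_sup => //; exists (N z).
  by split.
have : rs != [::] by rewrite -size_eq0 sz -lt0n.
elim: rs {rsE eigE sz} => [//|a rs IH] _.
case: (eqVneq rs [::]) => [->|/IH [z zrs zmax]].
  by exists a; rewrite ?mem_head // => y; rewrite inE => /eqP ->.
case: (lerP (N a) (N z)) => [az|/ltW za].
  exists z; first by rewrite inE zrs orbT.
  by move=> y; rewrite inE => /predU1P[->//|/zmax].
exists a; first exact: mem_head.
by move=> y; rewrite inE => /predU1P[->//|/zmax yz]; apply: le_trans za.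
Qed.

(* Main.v *)
(* M is circulant with generating function T(X) = prod_(i < s) (1 - X^(2^i)),
   because eta (2^m + n) = - eta n for n < 2^m; so its eigenvalues are the T(w)
   with w^p = 1. T(1) = 0. For w != 1, the conjugate of T(w) is T(w^-1), and
   since -1 is not a power of 2 mod p, T(w) T(w^-1) is the product of 1 - w^k
   over all nonzero k mod p, that is p. Hence lambda1^2 <= p, whereas p < 2^s
   because p divides 2^s - 1. *)
Require Import Defs.
From mathcomp Require Import all_boot all_order all_algebra.
From mathcomp Require Import classical_sets reals exp.
From mathcomp Require Import fingroup cyclic separable cyclotomic complex zify.

Import Order.TTheory GRing.Theory Num.Theory.

Local Open Scope ring_scope.

(** * Binary digits and the generating function of [eta] *)

(** Digits of index [a] or more vanish once [n < 2 ^ a]. This trades the cut-off in [s2], which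
    varies with [n], for a common one. *)
Lemma s2E m n : (n < 2 ^ m)%N -> s2 n = (\sum_(k < m) (n %/ 2 ^ k) %% 2)%N.
Proof.
have widen a b : (a <= b)%N -> (n < 2 ^ a)%N ->
    (\sum_(k < b) (n %/ 2 ^ k) %% 2 = \sum_(k < a) (n %/ 2 ^ k) %% 2)%N.
  move=> /subnKC <- ltn; elim: (b - a)%N => [|c IH]; first by rewrite addn0.
  rewrite addnS big_ord_recr /= IH divn_small ?mod0n ?addn0 //.
  by rewrite (leq_trans ltn) // leq_exp2l // leq_addr.
move=> ltn; rewrite /s2; case: (leqP m n) => [le_mn|/ltnW le_nm].
  exact: widen.
by rewrite (widen _ _ le_nm) // ltn_expl.
Qed.

Lemma eta_add_pow2 m n : (n < 2 ^ m)%N -> eta (2 ^ m + n) = - eta n.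
Proof.
move=> ltn; rewrite /eta -[RHS]mulN1r -exprS; congr (_ ^+ _).
rewrite (s2E m.+1) ?expnS ?mul2n -?addnn ?ltn_add2l //.
rewrite big_ord_recr /= divnDl // divnn expn_gt0 /= divn_small // addn0 addn1.
congr _.+1; rewrite (s2E m) //; apply: eq_bigr => k _.
(* Since [2 ^ m] is an even multiple of [2 ^ k], adding it leaves digit [k] unchanged. *)
have -> : (2 ^ m = 2 * 2 ^ (m - k.+1) * 2 ^ k)%N.
  by rewrite -expnS -expnD -subSn // subSS subnK // ltnW.
by rewrite divnMDl ?expn_gt0 // -modnDml modnMr add0n.
Qed.

(** By induction: the upper half of the range is the lower half shifted by [2 ^ m], which
    contributes the factor [- w ^+ (2 ^ m)]. *)
Lemma eta_genfun (C : comNzRingType) (w : C) m :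
  \sum_(0 <= n < 2 ^ m) (eta n)%:~R * w ^+ n
    = \prod_(i < m) (1 - w ^+ (2 ^ i)).
Proof.
elim: m => [|m IH].
  by rewrite big_nat1 big_ord0 /eta /s2 big_ord0 expr0 mulr1.
rewrite big_ord_recr /= -IH expnS mul2n -addnn.
rewrite (big_cat_nat (n := (2 ^ m)%N)) ?leq_addr //= mulrBr mulr1; congr (_ + _).
rewrite -{1}[(2 ^ m)%N]add0n big_addn addnK mulr_suml -sumrN !big_mkord.
apply: eq_bigr => n _.
by rewrite addnC eta_add_pow2 // mulrNz exprD mulNr mulrCA mulrC.
Qed.

(** * Powers of a [p]-th root of unity, with exponents in ['F_p] *)

Section Character.
Variables (p : nat) (C : fieldType) (w : C).
Hypotheses (p_pr : prime p) (wp : w ^+ p = 1).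

Let w_neq0 : w != 0.
Proof.
apply: contra_eq_neq wp => ->.
by rewrite expr0n gtn_eqF ?prime_gt0 // eq_sym oner_eq0.
Qed.

Lemma expr_Fp_natr n : w ^+ (n%:R : 'F_p) = w ^+ n.
Proof. by rewrite val_Fp_nat // expr_mod. Qed.

Lemma expr_Fp_oppr (x : 'F_p) : w ^+ (- x)%R = w ^- x.
Proof.
apply: (mulIf (expf_neq0 x w_neq0)); rewrite mulVf ?expf_neq0 //.
by rewrite -exprD -expr_Fp_natr natrD !natr_Zp addNr.
Qed.

Lemma prod_one_sub_pow : w != 1 ->
  \prod_(x : 'F_p | x != 0) (1 - w ^+ x) = p%:R.
Proof.
move=> w1.
(* The order of [w] divides the prime [p] and is not 1. *)
have w_prim : p.-primitive_root w.
  have [m w_m m_p] := prim_order_exists (prime_gt0 p_pr) wp.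
  have [_ /(_ m m_p) /pred2P[m1|<- //]] := primeP p_pr.
  by move: (prim_expr_order w_m) w1; rewrite m1 expr1 => ->; rewrite eqxx.
transitivity (\prod_(1 <= i < p) (1 - w ^+ i)).
  rewrite -(big_mkord (fun i => i != 0%N) (fun i => 1 - w ^+ i)).
  rewrite Fp_cast // big_ltn_cond ?prime_gt0 //= big_nat_cond [RHS]big_nat_cond.
  by apply: eq_bigl => i; rewrite lt0n; case: eqP; rewrite ?andbF ?andbT.
(* Cancel ['X - 1] from both factorizations of ['X^p - 1], then evaluate at 1. *)
have : \prod_(1 <= i < p) ('X - (w ^+ i)%:P) = \sum_(i < p) 'X^i :> {poly C}.
  apply: (mulfI (negbT (polyXsubC_eq0 (1 : C)))).
  by rewrite -subrX1 -(factor_Xn_sub_1 w_prim) [RHS]big_ltn ?prime_gt0.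
move/(congr1 (horner^~ 1)); rewrite horner_prod horner_sum.
under eq_bigr do rewrite hornerXsubC.
under [in RHS]eq_bigr do rewrite hornerXn expr1n.
by rewrite sumr_const card_ord.
Qed.

(** Each [n] is counted in exactly one column, the residue [j] of [i - n], and there [w ^+ j] equals
    [w ^+ i * w^-1 ^+ n]. *)
Lemma rarefied_row_transform (i : 'I_p) N :
  \sum_(j < p) (rarefied_sum ((i : nat)%:R - (j : nat)%:R : 'F_p) N)%:~R
     * w ^+ j = w ^+ i * \sum_(0 <= n < N) (eta n)%:~R * w^-1 ^+ n.
Proof.
transitivity (\sum_(j < p) \sum_(0 <= n < N)
  if n%:R == ((i : nat)%:R - (j : nat)%:R : 'F_p) then (eta n)%:~R * w ^+ j else 0).
  apply: eq_bigr => j _.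
  by rewrite /rarefied_sum rmorph_sum /= mulr_suml big_mkcond.
rewrite exchange_big /= mulr_sumr; apply: eq_bigr => n _.
rewrite -big_mkcond /=.
have [x xE] : exists x : 'F_p, x = (i : nat)%:R - n%:R by eexists.
have lt_p : (x < p)%N by rewrite -[X in (_ < X)%N](Fp_cast p_pr) ltn_ord.
rewrite (big_pred1 (Ordinal lt_p)) => [|j /=].
  rewrite mulrCA; congr (_ * _).
  apply: (mulIf (expf_neq0 n w_neq0)); rewrite exprVn -mulrA mulVf ?expf_neq0 // mulr1.
  by rewrite -exprD -[LHS]expr_Fp_natr natrD (natr_Zp x) xE subrK expr_Fp_natr.
rewrite eq_sym subr_eq addrC -subr_eq eq_sym -xE -(inj_eq val_inj).
by rewrite -[RHS](inj_eq val_inj) /= val_Fp_nat // modn_small.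
Qed.

End Character.

(** * Powers of 2 modulo [p] *)

Lemma eq_expr2_mod_ord2 p i j : prime p -> odd p ->
  (2%:R ^+ i == 2%:R ^+ j :> 'F_p) = (i == j %[mod ord2 p]).
Proof.
move=> p_pr p_odd.
(* This excludes the default value of [insubd] in [ord2]. *)
have u2 : (2%:R : 'F_p) \is a GRing.unit by rewrite unitFpE // coprimen2.
by rewrite -eq_expg_mod_order -[RHS](inj_eq val_inj) !FinRing.val_unitX insubdK.
Qed.

(* As p = 3 (mod 4), the order of 2 is odd, so -1 is not a power of 2; by
   counting, the powers of 2 and their opposites are all nonzero residues. *)
Lemma prod_one_sub_pow2 (C : fieldType) (w : C) p :
  P23 p -> w ^+ p = 1 -> w != 1 ->
  \prod_(i < ord2 p) (1 - w ^+ (2 ^ i)) *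
  \prod_(i < ord2 p) (1 - w^-1 ^+ (2 ^ i)) = p%:R.
Proof.
move=> [p_pr p_odd p_mod4 ordE] wp w1; rewrite -(prod_one_sub_pow _ _ _ p_pr wp w1).
set s := ord2 p.
have card_s : (s.*2 = p.-1)%N.
  by rewrite /s ordE divn2 -[RHS]odd_double_half -subn1 oddB ?prime_gt0 // p_odd.
have s_odd : odd s.
  have := divn_eq p 4; rewrite p_mod4 => pE.
  move: card_s; rewrite pE addnS /= -[(_ + _)%N]/(_ + 2)%N => sE.
  have -> : s = ((p %/ 4).*2.+1)%N by apply: double_inj; rewrite sE; lia.
  by rewrite /= odd_double.
have two_s : 2%:R ^+ s = 1 :> 'F_p.
  by apply/eqP; rewrite -(expr0 2%:R) eq_expr2_mod_ord2 // modnn mod0n.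
have two_neq0 : (2%:R : 'F_p) != 0.
  rewrite -(dvdn_pcharf (pchar_Fp p_pr)) dvdn_prime2 //.
  by apply: contraTneq p_odd => ->.
have N1 : (1 : 'F_p) != -1 by rewrite -subr_eq0 opprK.
pose h (x : 'I_s * bool) : 'F_p := (-1) ^+ x.2 * 2%:R ^+ x.1.
have h_inj : injective h.
  move=> [i b] [j c]; rewrite /h /= => e.
  have bc : b = c.
    (* Raising to the odd power [s] kills the power of 2 and keeps the sign. *)
    move/(congr1 (fun x => x ^+ s)): e.
    rewrite !exprMn -!exprM ![(_ * s)%N]mulnC !exprM two_s !expr1n !mulr1.
    rewrite -signr_odd s_odd expr1.
    by case: b c => [] [] //= /eqP; rewrite ?(eq_sym (-1)) (negPf N1).
  congr (_, _) => //; apply: val_inj => /=; move/eqP: e.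
  rewrite bc (inj_eq (mulfI _)) ?signr_eq0 // eq_expr2_mod_ord2 // !modn_small //.
  by move/eqP.
have h_im : h @: [set: 'I_s * bool] = [set x : 'F_p | x != 0].
  apply/eqP; rewrite eqEcard; apply/andP; split.
    apply/fintype.subsetP => _ /imsetP[x _ ->]; rewrite inE mulf_neq0 ?signr_eq0 //.
    by rewrite expf_neq0.
  rewrite card_imset // cardsT card_prod card_ord card_bool muln2 card_s.
  by rewrite cardsE cardC1 card_Fp.
transitivity (\prod_(x in h @: [set: 'I_s * bool]) (1 - w ^+ x)); last first.
  by apply: eq_bigl => x; rewrite h_im inE.
rewrite big_imset => [|x y _ _]; last exact: h_inj.
rewrite (eq_bigl xpredT) => [|x]; last by rewrite inE.
rewrite -(pair_bigA _ (fun i b => 1 - w ^+ h (i, b))) -big_split.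
apply: eq_bigr => i _.
transitivity ((1 - w ^+ h (i, true)) * (1 - w ^+ h (i, false))); last first.
  by rewrite big_bool.
have -> : h (i, true) = - (2 ^ i)%:R by rewrite /h expr1 mulN1r natrX.
have -> : h (i, false) = (2 ^ i)%:R by rewrite /h expr0 mul1r natrX.
by rewrite expr_Fp_oppr // !expr_Fp_natr // mulrC exprVn.
Qed.

(** * Eigenvalues of the circulant matrix *)

(** When [n] is nonzero in [C], ['X^n - 1] is separable, so its linear factors are distinct. *)
Lemma closed_field_unity_roots (C : closedFieldType) n : (n%:R : C) != 0 ->
  exists rs : seq C, [/\ uniq rs, size rs = n & forall w, w \in rs -> w ^+ n = 1].
Proof.
move=> n_neq0.
have n_gt0 : (0 < n)%N by rewrite lt0n; apply: contra_neq n_neq0 => ->.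
have [rs] := closed_field_poly_normal ('X^n - 1 : {poly C}).
have -> : lead_coef ('X^n - 1 : {poly C}) = 1.
  by apply/monicP/monicXnsubC.
rewrite scale1r => rsE; exists rs; split.
- by rewrite -separable_prod_XsubC -rsE separable_Xn_sub_1.
- by apply: succn_inj; rewrite -(size_prod_XsubC rs id) -rsE size_XnsubC.
- move=> w; rewrite -root_prod_XsubC -rsE => /rootP.
  by rewrite !hornerE => /eqP; rewrite subr_eq0 => /eqP.
Qed.

(* For an eigenvector v, the polynomial V = sum_j v_j X^j satisfies
   z V(w) = V(w) T(w^-1) whenever w^p = 1; having degree < p, V is nonzero at
   some such w. *)
Lemma eigenvalue_rarefied_mx (C : numClosedFieldType) p (z : C) :
  prime p -> eigenvalue (map_mx intr (rarefied_mx p)) z ->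
  exists2 w : C, w ^+ p = 1 & z = \prod_(i < ord2 p) (1 - w ^+ (2 ^ i)).
Proof.
move=> p_pr /eigenvalueP[v vM v_neq0].
have p_neq0 : (p%:R : C) != 0 by rewrite pnatr_eq0 -lt0n prime_gt0.
have [rs [rs_uniq rs_size rsP]] := closed_field_unity_roots _ _ p_neq0.
pose V : {poly C} := \sum_(i < p) v 0 i *: 'X^i.
have VE w : V.[w] = \sum_(i < p) v 0 i * w ^+ i.
  by rewrite horner_sum; apply: eq_bigr => i _; rewrite hornerZ hornerXn.
have V_neq0 : V != 0.
  apply: contra_neq v_neq0 => V0; apply/rowP => i; rewrite mxE.
  have := congr1 (fun q : {poly C} => q`_i) V0.
  rewrite coef0 coef_sum (bigD1 i) //= coefZ coefXn eqxx mulr1 big1 ?addr0 // => j ji.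
  by rewrite coefZ coefXn eq_sym (inj_eq val_inj) (negPf ji) mulr0.
have V_size : (size V <= p)%N.
  apply: (leq_trans (size_sum _ _ _)); apply/bigmax_leqP => i _.
  by rewrite (leq_trans (size_scale_leq _ _)) // size_polyXn.
have /allPn[w w_rs w_nroot] : ~~ all (root V) rs.
  apply: contraL V_size => all_rs; rewrite -ltnNge -rs_size.
  exact: max_poly_roots.
(* The inverse appears because the row transform at [w] yields the generating function at [w^-1]. *)
exists w^-1; first by rewrite exprVn rsP ?invr1.
apply: (mulIf w_nroot); rewrite -eta_genfun VE mulr_sumr.
transitivity (\sum_(j < p) (z *: v) 0 j * w ^+ j).
  by apply: eq_bigr => j _; rewrite mxE mulrA.
rewrite -vM.
transitivity (\sum_(j < p) \sum_(i < p) v 0 i *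
  ((rarefied_sum ((i : nat)%:R - (j : nat)%:R : 'F_p) (2 ^ ord2 p))%:~R * w ^+ j)).
  apply: eq_bigr => j _; rewrite mxE mulr_suml; apply: eq_bigr => i _.
  by rewrite !mxE mulrA.
rewrite exchange_big mulr_sumr; apply: eq_bigr => i _ /=.
rewrite -mulr_sumr rarefied_row_transform ?rsP //.
by rewrite mulrA mulrC.
Qed.

Lemma sqr_norm_eigenvalue_le (C : numClosedFieldType) p (z : C) : P23 p ->
  eigenvalue (map_mx intr (rarefied_mx p)) z -> `|z| ^+ 2 <= p%:R.
Proof.
move=> P23p; have [p_pr p_odd _ _] := P23p.
move=> /(eigenvalue_rarefied_mx _ _ _ p_pr)[w wp ->].
have [w1|w1] := eqVneq w 1.
  (* At [w = 1] every factor vanishes; positivity of [ord2 p] ensures that there is one. *)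
  have : (0 < ord2 p)%N by apply: order_gt0.
  case: (ord2 p) => // s _.
  by rewrite big_ord_recl w1 expr1n subrr mul0r normr0 expr0n ler0n.
have w_norm : `|w| = 1.
  by apply/eqP; rewrite -(@pexpr_eq1 _ _ p) ?prime_gt0 // -normrX wp normr1.
rewrite normCK rmorph_prod /= -(prod_one_sub_pow2 _ _ _ P23p wp w1).
(* On the unit circle inversion is conjugation, so the bound is in fact an equality here. *)
suff -> : w^-1 = w^*.
  by rewrite le_eqVlt; apply/orP; left; apply/eqP; congr (_ * _);
    apply: eq_bigr => i _; rewrite rmorphB rmorph1 rmorphXn.
by rewrite invC_norm w_norm expr1n invr1 mul1r.
Qed.

Lemma ltn_pow2_ord2 p : prime p -> odd p -> (p < 2 ^ ord2 p)%N.
Proof.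
move=> p_pr p_odd.
have two_s : 2%:R ^+ ord2 p = 1 :> 'F_p.
  by apply/eqP; rewrite -(expr0 2%:R) eq_expr2_mod_ord2 // modnn mod0n.
have s_gt0 : (0 < ord2 p)%N by apply: order_gt0.
have pow_gt1 : (1 < 2 ^ ord2 p)%N by rewrite -[1%N](expn0 2) ltn_exp2l.
have dvd : (p %| (2 ^ ord2 p).-1)%N.
  rewrite (dvdn_pcharf (pchar_Fp p_pr)) -subn1 natrB ?(ltnW pow_gt1) //.
  by rewrite natrX two_s subrr.
have := dvdn_leq _ dvd; lia.
Qed.

Theorem proposition5p7 (R : realType) :
  ~ exists p : nat, P23 p /\ 1 / 2%:R < beta R p.
Proof.
move=> [p [P23p]]; apply/negP; rewrite -leNgt.
have [p_pr p_odd _ _] := P23p.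
have s_gt0 : (0 < ord2 p)%N by apply: order_gt0.
have ln2_gt0 : 0 < ln (2%:R : R) by rewrite ln_gt0 ?ltr1n.
rewrite /beta ler_pdivrMr ?mulr_gt0 ?ltr0n //.
rewrite mulrC mul1r ler_pdivlMr ?ltr0n //.
have [[z z_eig normE] _] := lambda1_max R (prime_gt0 p_pr).
have lam_sqr : lambda1 R p ^+ 2 <= p%:R.
  have := sqr_norm_eigenvalue_le _ _ _ P23p z_eig.
  by rewrite -normE -lecR rmorphXn rmorph_nat.
(* [ln] is 0 at nonpositive arguments, which makes that case trivial. *)
have [lam_le0|lam_gt0] := leP (lambda1 R p) 0.
  by rewrite ln0 // mul0r mulr_ge0 ?ler0n ?ltW.
(* The goal becomes [lambda1 R p ^+ 2 <= 2 ^+ ord2 p], with [p] lying in between. *)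
rewrite mulr_natr -lnXn // mulrC mulr_natr -lnXn ?ltr0n //.
rewrite ler_ln ?posrE ?exprn_gt0 ?ltr0n //.
by apply: le_trans lam_sqr _; rewrite -natrX ler_nat ltnW ?ltn_pow2_ord2.
Qed.
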